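(* For each constant $\tau\geq \frac{4}{\ln 2}$ there exists $s_0=s_0(\tau)$ such that for all integers $s\geq s_0$ an $(N,s+3,2s+1)$-suitable core exists with $N=(s+3)(s-1)+\tau\ln s$.
   Context: Let $v,N,t$ be positive integers and $[v]=\{1,\dots,v\}$. An $N\times v$ array $C$ whose rows are permutations of $[v]$ is an $(N,v,t)$-suitable core if the following holds: choose $N$ new distinct symbols, prepend a different one of them to each row of $C$, and append the remaining $N-1$ new symbols (in arbitrary order) to that row; the resulting $N\times(v+N)$ array has the property that for every $t$-element subset $S$ of the $v+N$ symbols and every $\sigma\in S$ there is a row in which $\sigma$ occurs before every element of $S\setminus\{\sigma\}$. (Equivalently: for every symbol $\sigma\in[v]$ and every subset $T\subseteq[v]\setminus\{\sigma\}$, the number of rows of $C$ in which $\sigma$ precedes every element of $[v]\setminus(T\cup\{\sigma\})$ is at least $t+1-v+|T|$.) The paper tacitly treats quantities such as $\tau\ln s$ as integers. *)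

(* Defs.v *)
From HB Require Import structures.
From mathcomp Require Import all_boot all_order all_algebra all_fingroup.
From mathcomp Require Import all_classical all_reals all_analysis.

Set Implicit Arguments.
Unset Strict Implicit.
Unset Printing Implicit Defensive.

Definition suitable_array (N : nat) (X : finType) (t : nat)
    (A : 'I_N -> seq X) : Prop :=
  forall (S : {set X}) (x : X), #|S| = t -> x \in S ->
    exists i : 'I_N, forall y : X, y \in S -> y != x ->
      (index x (A i) < index y (A i))%N.

(* An N x v array of symbols from [v] whose rows are permutations is a map
   C : 'I_N -> {perm 'I_v}, with C i j the entry in row i and column j. The
   enlarged array uses the symbols 'I_v + 'I_N, the right summand holding the N
   new symbols: first i is prepended to row i and rest i is appended to it. *)
Definition extend_array (N v : nat) (C : 'I_N -> {perm 'I_v})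
    (first : {perm 'I_N}) (rest : 'I_N -> seq 'I_N)
    (i : 'I_N) : seq ('I_v + 'I_N)%type :=
  inr (first i) :: [seq inl (C i j) | j <- enum 'I_v] ++
    [seq inr k | k <- rest i].

(* first being a permutation says that distinct rows get distinct new symbols;
   rest i lists the other N - 1 new symbols in an arbitrary order. *)
Definition suitable_core (N v t : nat) (C : 'I_N -> {perm 'I_v}) : Prop :=
  forall (first : {perm 'I_N}) (rest : 'I_N -> seq 'I_N),
    (forall i : 'I_N, perm_eq (rest i) (rem (first i) (enum 'I_N))) ->
    suitable_array t (extend_array C first rest).

(* Main.v *)
Require Import Defs.
From mathcomp Require Import all_boot all_order all_algebra all_fingroup.
From mathcomp Require Import all_classical all_reals all_analysis.
From mathcomp Require Import fintype finset zify lra.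

Set Implicit Arguments.
Unset Strict Implicit.
Unset Printing Implicit Defensive.
Import Order.TTheory GRing.Theory Num.Theory.

(** For a symbol x and a set T of other symbols, the core needs s - 1 + #|T|
rows in which everything before x lies in T. Split the s + 3 symbols into s
ordinary and three special ones. Use the rows starting a b, for ordinary a <>
b, and the rows starting i a, for i special and a ordinary: each ordinary x
then starts s - 1 rows and is second after every other symbol, which is exactly
what x needs. The third symbol of the row a b is special. If the pairs {a, b}
served by the special symbol i have independence number less than m, then any T
contains at least #|T| - m + 1 of them (counting only ordinary symbols of T),
and starting m further rows with i makes up for the deficit and for the other
special symbols in T. Of the two rows a b and b a, one serves the third special
symbol, for which m = 2 suffices, and the other serves the first or the second
according to a 2-colouring of the complete graph on the ordinary symbols
without monochromatic clique of size m. By Erdős' bound such a colouring exists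
with m close to 2 log_2 s, so the extra rows number about 4 log_2 s. *)

Lemma leq_card_bigcup (I X : finType) (P : pred I) (A : I -> {set X}) :
  #|\bigcup_(i | P i) A i| <= \sum_(i | P i) #|A i|.
Proof.
elim/big_ind2: _ => [|B m C n leBm leCn|//]; first by rewrite cards0.
by rewrite (leq_trans (leq_card_setU _ _)) ?leq_add.
Qed.

Lemma card_preim_inl_inr (X Y : finType) (S : {set X + Y}) :
  #|S| = #|inl @^-1: S| + #|inr @^-1: S|.
Proof.
rewrite -sum1_card big_sumType /= !sum1_card.
by congr (_ + _); apply: eq_card => z; rewrite inE.
Qed.

Lemma card_preim_lshift_rshift (m n : nat) (T : {set 'I_(m + n)}) :
  #|T| = #|@lshift m n @^-1: T| + #|@rshift m n @^-1: T|.
Proof.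
rewrite -sum1_card big_split_ord /= !sum1_card.
by congr (_ + _); apply: eq_card => z; rewrite inE.
Qed.

Lemma card_offdiagonal (X : finType) :
  #|[set p : X * X | p.1 != p.2]| = #|X| * #|X|.-1.
Proof.
rewrite -sum1dep_card.
rewrite -(pair_big_dep xpredT (fun x y => x != y) (fun _ _ => 1)) /=.
rewrite -sum_nat_const; apply: eq_bigr => x _; rewrite sum1_card -(cardC1 x).
by apply: eq_card => y; rewrite !inE eq_sym.
Qed.

Lemma count_map_enum (X : finType) (Y : Type) (f : X -> Y) (a : pred Y)
    (A : {set X}) :
  count a [seq f x | x <- enum A] = #|[set x in A | a (f x)]|.
Proof.
rewrite count_map -sum1_count big_enum_cond /= sum1_card.
by apply: eq_card => x; rewrite !inE.
Qed.

Lemma leq_count_card_nth (X : Type) (x0 : X) (a : pred X) (l : seq X)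
    (n : nat) :
  size l <= n -> count a l <= #|[set i : 'I_n | a (nth x0 l i)]|.
Proof.
move=> le_ln; rewrite -sum1_count (big_nth x0) big_mkord.
rewrite (big_ord_widen_cond n (fun i => a (nth x0 l i)) (fun=> 1)) // sum1_card.
by apply/subset_leq_card/subsetP => i; rewrite !inE => /andP[].
Qed.

Lemma uniq_prefix_perm (v : nat) (p : seq 'I_v) :
  uniq p -> exists pi : {perm 'I_v}, prefix p (codom pi).
Proof.
move=> Up; pose w := p ++ [seq x <- enum 'I_v | x \notin p].
have /tuple_permP[pi def_w] : perm_eq w (ord_tuple v).
  apply: uniq_perm => [||x].
  - rewrite cat_uniq Up filter_uniq ?enum_uniq // andbT; apply/hasPn => x.
    by rewrite mem_filter => /andP[].
  - exact: enum_uniq.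
  - by rewrite mem_cat mem_filter mem_enum andbT orbN.
exists pi; apply/prefixP; exists [seq x <- enum 'I_v | x \notin p].
by rewrite -/w def_w; apply: eq_map => j /=; rewrite tnth_ord_tuple.
Qed.

Definition leads (X : finType) (T : {set X}) (x : X) (p : seq X) : bool :=
  ohead [seq y <- p | y \notin T] == Some x.

Lemma leads_cons (X : finType) (T : {set X}) (x y : X) (p : seq X) :
  x \notin T -> leads T x (y :: p) = (x == y) || (y \in T) && leads T x p.
Proof.
move=> xT; rewrite /leads /=; case: (boolP (y \in T)) => yT /=.
  by have /negbTE-> : x != y by apply: contraNneq xT => ->.
by rewrite orbF eq_sym.
Qed.

Lemma leads_prefix (X : finType) (T : {set X}) (x : X) (p r : seq X) :
  prefix p r -> leads T x p -> leads T x r.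
Proof.
by case/prefixP=> u ->; rewrite /leads filter_cat; case: [seq _ <- p | _].
Qed.

Lemma leads_index_lt (X : finType) (T : {set X}) (x y : X) (p : seq X) :
  leads T x p -> y \notin T -> y != x -> index x p < index y p.
Proof.
rewrite /leads => + yT yx; elim: p => //= z p IHp; case: ifP => [_|/negbFE zT].
  by move=> /eqP[->]; rewrite eqxx eq_sym (negbTE yx).
have zy : z != y by apply: contraNneq yT => <-.
by rewrite (negbTE zy) => /IHp; case: (z == x).
Qed.

Lemma index_inl_extend_array (N v : nat) (C : 'I_N -> {perm 'I_v})
    (first : {perm 'I_N}) (rest : 'I_N -> seq 'I_N) (i : 'I_N) (x : 'I_v) :
  index (inl x) (extend_array C first rest i) = (index x (codom (C i))).+1.
Proof.
have inl_inj := @inl_inj 'I_v 'I_N.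
rewrite /extend_array (map_comp inl (C i)) /= index_cat mem_map //.
by rewrite -[x in x \in _](permKV (C i)) codom_f index_map.
Qed.

Lemma index_inr_extend_array (N v : nat) (C : 'I_N -> {perm 'I_v})
    (first : {perm 'I_N}) (rest : 'I_N -> seq 'I_N) (i k : 'I_N) :
  k != first i -> v < index (inr k) (extend_array C first rest i).
Proof.
move=> k_first; rewrite /extend_array /= (inj_eq (@inr_inj _ _)).
rewrite eq_sym (negbTE k_first) ltnS index_cat ifF; last by apply/mapP => -[].
by rewrite size_map size_enum_ord leq_addr.
Qed.

Lemma suitable_core_of_leads (N v t : nat) (C : 'I_N -> {perm 'I_v}) :
  (forall (x : 'I_v) (T : {set 'I_v}), x \notin T ->
     t + #|T| < v + #|[set i | leads T x (codom (C i))]|) ->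
  suitable_core t C.
Proof.
move=> many_leads first rest _ S [x|k] card_S xS; last first.
  exists ((first^-1)%g k) => y _; rewrite /extend_array permKV /= eqxx.
  by rewrite [inr k == y]eq_sym => /negbTE->.
pose T := ~: (inl @^-1: S); pose new := inr @^-1: S.
have card_ST : #|S| + #|T| = v + #|new|.
  by rewrite (card_preim_inl_inr S) addnAC cardsC card_ord.
have xT : x \notin T by rewrite !inE negbK.
have /subsetPn[_ /imsetP[i i_leads ->] first_new] :
    ~~ ([set first i | i in [set i | leads T x (codom (C i))]] \subset new).
  have := many_leads x T xT; rewrite -card_S card_ST ltn_add2l ltnNge.
  by apply: contra => /subset_leq_card; rewrite card_imset //; exact: perm_inj.
rewrite inE in i_leads; exists i => -[y|k] yS.
  rewrite !index_inl_extend_array ltnS => yx.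
  apply: leads_index_lt i_leads _ _ => //.
  by rewrite !inE negbK.
have k_first : k != first i by apply: contraNneq first_new => <-; rewrite inE.
rewrite index_inl_extend_array => _.
apply: leq_trans (index_inr_extend_array C rest k_first).
rewrite ltnS -[X in _ < X]card_ord -(size_codom (C i)) index_mem.
by rewrite -[x](permKV (C i)) codom_f.
Qed.

Lemma suitable_core_of_prefixes (N v t : nat) (L : seq (seq 'I_v)) :
  size L <= N -> all uniq L ->
  (forall (x : 'I_v) (T : {set 'I_v}), x \notin T ->
     t + #|T| < v + count (leads T x) L) ->
  exists C : 'I_N -> {perm 'I_v}, suitable_core t C.
Proof.
move=> size_L uniq_L many_leads.
have uniq_row (i : 'I_N) : uniq (nth [::] L i).
  have [iL|Li] := ltnP i (size L); last by rewrite nth_default.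
  exact: (allP uniq_L) (mem_nth _ iL).
have [C prefix_C] := choice (fun i : 'I_N => uniq_prefix_perm (uniq_row i)).
exists C; apply: suitable_core_of_leads => x T xT.
apply: leq_trans (many_leads x T xT) _; rewrite leq_add2l.
apply: leq_trans (leq_count_card_nth [::] _ size_L) _.
apply/subset_leq_card/subsetP => i; rewrite !inE.
exact: leads_prefix.
Qed.

Definition monochromatic (X : finType) (E D : {set X}) : bool :=
  (D \subset E) || (D \subset ~: E).

Lemma card_monochromatic (X : finType) (D : {set X}) :
  #|[set E | monochromatic E D]| <= 2 * 2 ^ #|~: D|.
Proof.
have card_disjoint : #|[set E : {set X} | D \subset ~: E]| = 2 ^ #|~: D|.
  rewrite -card_powerset; apply: eq_card => E.
  by rewrite inE powersetE subsetC.
have card_superset : #|[set E : {set X} | D \subset E]| = 2 ^ #|~: D|.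
  rewrite -card_disjoint -(card_preimset _ (@setC_inj X)).
  by apply: eq_card => E; rewrite !inE.
rewrite mul2n -addnn -{1}card_superset -card_disjoint.
apply: leq_trans (leq_card_setU _ _); apply: subset_leq_card.
by apply/subsetP => E; rewrite !inE.
Qed.

Lemma property_B (X : finType) (F : {set {set X}}) (d : nat) :
  (forall D, D \in F -> d <= #|D|) -> 2 * #|F| < 2 ^ d ->
  exists E : {set X}, forall D, D \in F -> ~~ monochromatic E D.
Proof.
move=> leq_d card_F.
pose bad := \bigcup_(D in F) [set E | monochromatic E D].
have card_bad : #|bad| * 2 ^ d <= 2 * #|F| * 2 ^ #|X|.
  apply: leq_trans (leq_mul (leq_card_bigcup _ _) (leqnn _)) _.
  rewrite (mulnC 2) -mulnA big_distrl /= -sum_nat_const leq_sum // => D DF.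
  apply: leq_trans (leq_mul (card_monochromatic D) (leqnn _)) _.
  rewrite -mulnA leq_mul2l -expnD leq_exp2l // -(cardsC D) addnC.
  by rewrite leq_add2r leq_d.
have /subsetPn[E _ E_good] : ~~ ([set: {set X}] \subset bad).
  apply: contraL card_F => /subset_leq_card.
  rewrite -powersetT card_powerset cardsT -leqNgt => card_le.
  rewrite -(leq_pmul2r (expn_gt0 2 #|X|)); apply: leq_trans card_bad.
  by rewrite mulnC leq_mul2r card_le orbT.
exists E => D DF; apply: contra E_good => E_bad.
by apply/bigcupP; exists D; rewrite ?inE.
Qed.

Definition no_independent_set (X : finType) (m : nat) (e : rel X) : Prop :=
  forall K : {set X}, #|K| = m -> exists x y, [/\ x \in K, y \in K & e x y].

Lemma orient_no_independent_set (X : finType) (m : nat) (e f : rel X) :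
  (forall x y, e x y -> f x y || f y x) ->
  no_independent_set m e -> no_independent_set m f.
Proof.
move=> sub_ef nis_e K /nis_e[x [y [xK yK /sub_ef]]].
by case/orP=> fxy; [exists x, y | exists y, x].
Qed.

Lemma no_independent_set2_neq (X : finType) :
  no_independent_set 2 (fun x y : X => x != y).
Proof.
move=> K /eqP/cards2P[x [y [xy ->]]].
by exists x, y; rewrite !inE !eqxx orbT.
Qed.

(* Deleting from T one end of an edge loses at least that edge. *)
Lemma card_lt_add_edges (X : finType) (e : rel X) (m : nat) :
  no_independent_set m e -> forall T : {set X},
    #|T| < m + #|[set p in setX T T | e p.1 p.2]|.
Proof.
move=> nis_e T; elim/ltn_ind: {T}#|T| {-2}T (erefl #|T|) => n IH T card_T.
have [nm|mn] := ltnP n m; first by rewrite card_T ltn_addr.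
have [K KT card_K] : exists2 K : {set X}, K \subset T & #|K| = m.
  have : 0 < 'C(#|T|, m) by rewrite bin_gt0 card_T.
  rewrite -cards_draws => /card_gt0P[K]; rewrite inE => /andP[KT /eqP card_K].
  by exists K.
have [x [y [/(subsetP KT) xT /(subsetP KT) yT xy]]] := nis_e K card_K.
have card_Tx : #|T| = #|T :\ x|.+1 by rewrite (cardsD1 x) xT.
have IHx : #|T :\ x| < m + #|[set p in setX (T :\ x) (T :\ x) | e p.1 p.2]|.
  by apply: IH (erefl _); rewrite -card_T card_Tx.
rewrite card_Tx; apply: leq_ltn_trans IHx _; rewrite ltn_add2l.
apply/proper_card/properP; split.
  apply/subsetP => -[u w]; rewrite !inE /=.
  by case/andP=> /andP[/andP[_ ->] /andP[_ ->]] ->.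
by exists (x, y); rewrite !inE ?eqxx ?xT ?yT.
Qed.

Definition edges (X : finType) (K : {set X}) : {set {set X}} :=
  [set B : {set X} | B \subset K & #|B| == 2].

Lemma ramsey_lower_bound (X : finType) (m : nat) :
  2 * 'C(#|X|, m) < 2 ^ 'C(m, 2) ->
  exists E : {set {set X}},
    forall K : {set X}, #|K| = m -> ~~ monochromatic E (edges K).
Proof.
move=> few_cliques.
have [_ /imsetP[K + ->]||E E_good] :=
    @property_B _ [set edges K | K in [set K : {set X} | #|K| == m]] 'C(m, 2).
- by rewrite inE => /eqP <-; rewrite cards_draws.
- rewrite (leq_ltn_trans _ few_cliques) // leq_mul2l -card_draws.
  exact: leq_imset_card.
by exists E => K card_K; apply: E_good; rewrite imset_f // inE card_K.
Qed.

Lemma color_class_no_independent_set (X : finType) (E : {set {set X}}) (m : nat)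
    (c : bool) :
  (forall K : {set X}, #|K| = m -> ~~ monochromatic E (edges K)) ->
  no_independent_set m (fun x y => (x != y) && (([set x; y] \in E) == c)).
Proof.
move=> nonmono K /nonmono /norP[not_sub not_disj].
have [B BK BE] : exists2 B, B \in edges K & (B \in E) = c.
  case: c; first by case/subsetPn: not_disj => B ?; rewrite inE negbK; exists B.
  by case/subsetPn: not_sub => B ? /negbTE; exists B.
move: BK; rewrite inE => /andP[/subsetP BK /cards2P[x [y [xy def_B]]]].
exists x, y; rewrite -def_B BE xy eqxx; split => //; apply: BK.
  by rewrite def_B set21.
by rewrite def_B set22.
Qed.

Lemma expn_lt_fact (c m : nat) : 1 < c -> 2 * c ^ 2 < m -> c ^ m < m`!.
Proof.
move=> c_gt1 c_lt_m.
have expn_leq_fact n d : n ^ d <= (n + d)`!.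
  elim: d => [|d IHd]; first by rewrite addn0 fact_gt0.
  by rewrite addnS factS expnS leq_mul // -addnS leq_addr.
have leq_c2m : c ^ 2 <= m by lia.
rewrite -(subnKC leq_c2m); apply: leq_trans (expn_leq_fact _ _).
by rewrite -expnM ltn_exp2l // subnKC //; lia.
Qed.

Lemma ffact_leq_expn (n m : nat) : n ^_ m <= n ^ m.
Proof.
by elim: m => // m IHm; rewrite ffactnSr expnSr leq_mul ?leq_subr.
Qed.

Lemma bin_lt_exp_bin2 (c s m : nat) :
  1 < c -> 2 * c ^ 2 < m -> (2 * s) ^ 2 <= c ^ 2 * 2 ^ m ->
  2 * 'C(s, m) < 2 ^ 'C(m, 2).
Proof.
move=> c_gt1 c_lt_m s_small.
have m_gt1 : 1 < m by nia.
have bin2m : 'C(m, 2) * 2 + m = m * m.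
  by rewrite -[X in _ * X]/(2`!) bin_ffact ffactnS ffactn1; nia.
have sq_bound : (2 * s ^ m) ^ 2 <= (c ^ m * 2 ^ 'C(m, 2)) ^ 2.
  rewrite -(leq_pmul2r (expn_gt0 2 m)).
  have -> : (c ^ m * 2 ^ 'C(m, 2)) ^ 2 * 2 ^ m = (c ^ 2 * 2 ^ m) ^ m.
    rewrite [(_ * _) ^ 2]expnMn [(_ * _) ^ m]expnMn -!expnM -mulnA -expnD bin2m.
    by rewrite [m * 2]mulnC.
  apply: (@leq_trans (((2 * s) ^ 2) ^ m)); last by rewrite leq_exp2r // ltnW.
  rewrite -[in leqRHS]expnM [leqRHS]expnMn [(_ * _) ^ 2]expnMn -expnM mulnAC.
  by rewrite [m * 2]mulnC leq_mul2r -expnD leq_exp2l //; lia.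
rewrite -(ltn_pmul2r (fact_gt0 m)) -mulnA bin_ffact.
apply: (@leq_ltn_trans (2 * s ^ m)); first by rewrite leq_mul2l ffact_leq_expn.
rewrite leq_sqr in sq_bound; apply: leq_ltn_trans sq_bound _.
by rewrite mulnC ltn_pmul2l ?expn_gt0 // expn_lt_fact.
Qed.

Section ThirdSymbolConstruction.
Variables (s q : nat) (third : 'I_s -> 'I_s -> 'I_q) (extra : 'I_q -> nat).

(* The ordinary symbols are the lshift q a, the special ones the rshift s i. *)
Definition pair_rows : seq (seq 'I_(s + q)) :=
  [seq [:: lshift q p.1; lshift q p.2; rshift s (third p.1 p.2)]
    | p <- enum [set p : 'I_s * 'I_s | p.1 != p.2]].

Definition mixed_rows : seq (seq 'I_(s + q)) :=
  [seq [:: rshift s p.1; lshift q p.2] | p <- enum [set: 'I_q * 'I_s]].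

Definition extra_rows : seq (seq 'I_(s + q)) :=
  flatten [seq nseq (extra i) [:: rshift s i] | i <- enum 'I_q].

Definition row_prefixes : seq (seq 'I_(s + q)) :=
  pair_rows ++ mixed_rows ++ extra_rows.

Lemma size_row_prefixes :
  size row_prefixes = s * s.-1 + q * s + \sum_i extra i.
Proof.
rewrite !size_cat !size_map -!cardE card_offdiagonal cardsT card_prod !card_ord.
rewrite addnA size_flatten /shape -map_comp sumnE big_map big_enum /=.
by congr (_ + _); apply: eq_bigr => i _; rewrite size_nseq.
Qed.

Lemma uniq_row_prefixes : all uniq row_prefixes.
Proof.
rewrite !all_cat; apply/and3P; split; apply/allP.
- move=> _ /mapP[p + ->]; rewrite mem_enum inE /= !inE.
  by rewrite eq_lshift !eq_lrshift orbF andbT => ->.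
- by move=> _ /mapP[p _ ->]; rewrite /= inE eq_rlshift.
- by move=> p /flattenP[_ /mapP[i _ ->]]; rewrite mem_nseq => /andP[_ /eqP->].
Qed.

Variable T : {set 'I_(s + q)}.

Lemma leq_count_leads_lshift (a : 'I_s) :
  lshift q a \notin T ->
  s + #|T| <= (count (leads T (lshift q a)) row_prefixes).+1.
Proof.
move=> aT.
suff : s.-1 + #|T| <= count (leads T (lshift q a)) row_prefixes.
  by rewrite -ltnS -addSn prednK // (leq_ltn_trans _ (ltn_ord a)).
rewrite !count_cat (card_preim_lshift_rshift T) !addnA.
set TA := lshift q @^-1: T; set TB := _ @^-1: T.
have pairs_a : s.-1 + #|TA| <= count (leads T (lshift q a)) pair_rows.
  pose first_a := [set (a, b) | b in [set~ a]].
  pose second_a := [set (b, a) | b in TA].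
  have disj : [disjoint first_a & second_a].
    rewrite -setI_eq0; apply/set0Pn => -[_ /setIP[/imsetP[b _ ->]]].
    by case/imsetP=> c + [ac _]; rewrite -ac inE (negbTE aT).
  have -> : s.-1 + #|TA| = #|first_a :|: second_a|.
    rewrite cardsU (disjoint_setI0 disj) cards0 subn0.
    by rewrite !card_imset ?cardsC1 ?card_ord // => b c [].
  rewrite count_map_enum; apply/subset_leq_card/subsetP => p.
  case/setUP=> /imsetP[b + ->]; rewrite !inE /=.
    by rewrite eq_sym leads_cons // eqxx => ->.
  move=> bT; rewrite !leads_cons // bT eqxx orbT andbT.
  by apply: contraNneq aT => <-.
have mixed_a : #|TB| <= count (leads T (lshift q a)) mixed_rows.
  have pair_inj : injective (fun i : 'I_q => (i, a)) by move=> i j [].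
  rewrite count_map_enum -(card_imset TB pair_inj).
  apply/subset_leq_card/subsetP => _ /imsetP[i + ->].
  by rewrite !inE /= !leads_cons // eqxx andbT => ->; rewrite orbT.
by rewrite (leq_trans _ (leq_addr _ _)) // leq_add.
Qed.

Lemma leq_count_leads_rshift (i : 'I_q) (m : nat) :
  no_independent_set m (fun a b => (a != b) && (third a b == i)) ->
  m + q <= extra i + 3 -> rshift s i \notin T ->
  s + #|T| <= (count (leads T (rshift s i)) row_prefixes).+1.
Proof.
move=> nis_i surplus iT; rewrite !count_cat (card_preim_lshift_rshift T).
set TA := lshift q @^-1: T; set TB := _ @^-1: T.
have pairs_i : #|TA| < m + count (leads T (rshift s i)) pair_rows.
  rewrite count_map_enum; apply: leq_trans (card_lt_add_edges nis_i TA) _.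
  rewrite leq_add2l; apply/subset_leq_card/subsetP => -[a b]; rewrite !inE /=.
  case/andP=> /andP[aT bT] /andP[-> /eqP->].
  by rewrite !leads_cons // aT bT eqxx !orbT.
have mixed_i : s <= count (leads T (rshift s i)) mixed_rows.
  have pair_inj : injective (fun a : 'I_s => (i, a)) by move=> a b [].
  rewrite count_map_enum -[leqLHS]card_ord -cardsT -(card_imset _ pair_inj).
  apply/subset_leq_card/subsetP => _ /imsetP[a _ ->].
  by rewrite !inE /= leads_cons // eqxx.
have extra_i : extra i <= count (leads T (rshift s i)) extra_rows.
  rewrite count_flatten -map_comp sumnE big_map big_enum /= (bigD1 i) //=.
  by rewrite count_nseq leads_cons // eqxx mul1n leq_addr.
have card_TB : #|TB| < q.
  rewrite -[X in _ < X]card_ord -cardsT proper_card // properT.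
  apply: contraNneq iT => TB_full.
  by have := in_setT i; rewrite -TB_full inE.
lia.
Qed.

End ThirdSymbolConstruction.

Lemma suitable_core_of_third_symbols (s q t N : nat)
    (third : 'I_s -> 'I_s -> 'I_q) (m extra : 'I_q -> nat) :
  (forall i,
    no_independent_set (m i) (fun a b => (a != b) && (third a b == i))) ->
  (forall i, m i + q <= extra i + 3) -> t + 2 <= 2 * s + q ->
  s * s.-1 + q * s + \sum_i extra i <= N ->
  exists C : 'I_N -> {perm 'I_(s + q)}, suitable_core t C.
Proof.
move=> nis_third surplus leq_t leq_N.
apply: (suitable_core_of_prefixes (L := row_prefixes third extra)).
- by rewrite size_row_prefixes.
- exact: uniq_row_prefixes.
- move=> x T xT.
  suff : s + #|T| <= (count (leads T x) (row_prefixes third extra)).+1 by lia.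
  case: (split_ordP x) xT => [a|i] ->; first exact: leq_count_leads_lshift.
  exact: leq_count_leads_rshift.
Qed.

Lemma suitable_core_of_ramsey (s m N : nat) :
  2 * 'C(s, m) < 2 ^ 'C(m, 2) -> s * s.-1 + 3 * s + (2 * m + 2) <= N ->
  exists C : 'I_N -> {perm 'I_(s + 3)}, suitable_core (2 * s + 1) C.
Proof.
rewrite -[X in 'C(X, _)](card_ord s) => /ramsey_lower_bound[E nonmono] leq_N.
pose third (a b : 'I_s) : 'I_3 :=
  if a < b then inord 2 else inord ([set a; b] \in E).
pose indep (i : 'I_3) := if i == 2 :> nat then 2 else m.
apply: (@suitable_core_of_third_symbols s 3 _ N third indep indep) => [i|//||].
- rewrite /indep; case: ifP => [/eqP i2|/negbT i2].
    apply: orient_no_independent_set (@no_independent_set2_neq _) => a b ab.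
    rewrite (eq_sym b) ab /third -!val_eqE /= i2.
    by case/orP: (etrans (esym (neq_ltn a b)) ab) => ->; rewrite inordK ?orbT.
  apply: orient_no_independent_set
    (color_class_no_independent_set (i == 1 :> nat) nonmono) => a b.
  case/andP=> ab /eqP color_ab.
  have color_i : inord ([set a; b] \in E) = i.
    apply: val_inj; rewrite color_ab /= inordK ?(leq_ltn_trans (leq_b1 _)) //.
    by case: i i2 {color_ab} => [[|[|[|]]]].
  rewrite (eq_sym b) ab /third (setUC [set b]) color_i.
  by case: ltngtP ab => // [_|_|/val_inj->]; rewrite eqxx ?orbT.
- lia.
- by rewrite /indep !big_ord_recr big_ord0 /= (leq_trans _ leq_N) //; lia.
Qed.

(* The bound on k makes the clique size (k - 5)./2 exceed the 2 * 8 ^ 2 demanded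
   by bin_lt_exp_bin2. *)
Lemma suitable_core_of_surplus (s k : nat) :
  0 < s -> s ^ 4 <= 2 ^ k.+1 -> 263 <= k ->
  exists C : 'I_((s + 3) * (s - 1) + k) -> {perm 'I_(s + 3)},
    suitable_core (2 * s + 1) C.
Proof.
move=> s_gt0 s4 k_large; pose m := (k - 5)./2.
apply: (@suitable_core_of_ramsey s m); last first.
  by rewrite /m; nia.
apply: (@bin_lt_exp_bin2 8) => //; first by rewrite /m; lia.
rewrite -[8]/(2 ^ 3) -expnM -expnD -leq_sqr -expnM [leqLHS]expnMn -expnM.
apply: leq_trans (leq_mul (leqnn _) s4) _.
by rewrite -expnD leq_exp2l // /m; lia.
Qed.

Lemma leq_exponent_of_expn (b n s d k : nat) :
  1 < b -> 0 < d -> b ^ n <= s -> s ^ d <= b ^ k -> n <= k.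
Proof.
move=> b_gt1 d_gt0 s_large s_small; rewrite -(leq_exp2l _ _ b_gt1).
apply: leq_trans s_small; apply: leq_trans s_large _.
by rewrite -[leqLHS]expn1; case: s => [|s]; rewrite ?exp0n // leq_pexp2l.
Qed.

Local Open Scope ring_scope.

Lemma expn_leq_of_ln (R : realType) (tau : R) (a b s k : nat) :
  (0 < s)%N -> (1 < b)%N -> a%:R / ln b%:R <= tau -> tau * ln s%:R <= k%:R ->
  (s ^ a <= b ^ k)%N.
Proof.
move=> s_gt0 b_gt1 leq_tau leq_k.
have b_gt0 := ltnW b_gt1.
have ln_b : 0 < ln b%:R :> R by rewrite ln_gt0 // ltr1n.
have ln_s : 0 <= ln s%:R :> R by rewrite ln_ge0 // ler1n.
rewrite -(ler_nat R) !natrX -ler_ln ?posrE ?exprn_gt0 ?ltr0n //.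
rewrite !lnXn ?ltr0n // -[_ *+ a]mulr_natl -[_ *+ k]mulr_natl.
rewrite -(divfK (lt0r_neq0 ln_b) a%:R) mulrAC ler_pM2r //.
exact: le_trans (ler_wpM2r ln_s leq_tau) leq_k.
Qed.

Lemma surplus_of_round (R : realType) (tau : R) (s N : nat) :
  (0 < s)%N -> 0 <= tau ->
  `| N%:R - ((s%:R + 3) * (s%:R - 1) + tau * ln s%:R) | < 1 ->
  exists2 k : nat, N = ((s + 3) * (s - 1) + k)%N & tau * ln s%:R <= k.+1%:R.
Proof.
move=> s_gt0 tau_ge0; pose M := ((s + 3) * (s - 1))%N.
have <- : M%:R = (s%:R + 3) * (s%:R - 1) :> R by rewrite natrM natrD natrB.
rewrite ltr_norml => /andP[N_lower _].
have surplus_ge0 : 0 <= tau * ln s%:R by rewrite mulr_ge0 // ln_ge0 // ler1n.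
have leq_MN : (M <= N)%N by rewrite -ltnS -(ltr_nat R) -natr1; lra.
exists (N - M)%N; first by rewrite subnKC.
by rewrite -natr1 natrB //; lra.
Qed.

(* N ranges over the natural numbers obtained by rounding
   (s + 3) (s - 1) + tau * ln s, downwards or upwards, to an integer. *)
Theorem theorem3 (R : realType) (tau : R) (htau : 4 / ln 2 <= tau) :
  exists s0 : nat, forall s : nat, (s0 <= s)%N ->
    forall N : nat,
      `| N%:R - ((s%:R + 3) * (s%:R - 1) + tau * ln s%:R) | < 1 ->
      exists C : 'I_N -> {perm 'I_(s + 3)}, suitable_core (2 * s + 1) C.
Proof.
have tau_ge0 : 0 <= tau.
  by apply: le_trans htau; rewrite divr_ge0 // ln_ge0 // ler1n.
exists (2 ^ 264)%N => s s_large N N_round.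
have s_gt0 : (0 < s)%N by apply: leq_trans s_large; rewrite expn_gt0.
have [k -> leq_k] := surplus_of_round s_gt0 tau_ge0 N_round.
have s4 : (s ^ 4 <= 2 ^ k.+1)%N by exact: expn_leq_of_ln htau leq_k.
have k_large : (264 <= k.+1)%N by apply: leq_exponent_of_expn s_large s4.
exact: suitable_core_of_surplus.
Qed.
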